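(* Let $T:\mathcal{M}_d\to\mathcal{M}_d$ be a quantum channel, i.e. a linear, completely positive, trace-preserving map on complex $d\times d$ matrices. Then the following are equivalent: (1) $T$ is unital, i.e. $T(\mathbb{1})=\mathbb{1}$; (2) $T$, regarded as a linear operator on the Hilbert–Schmidt Hilbert space (the space $\mathcal{M}_d$ with inner product $\langle A,B\rangle=\operatorname{tr}[A^\dagger B]$), is a convex combination of unitary operators on that Hilbert space, i.e. $T=\sum_\alpha p_\alpha W_\alpha$ with probabilities $p_\alpha\ge 0$, $\sum_\alpha p_\alpha=1$, and each $W_\alpha$ a unitary operator on the Hilbert–Schmidt space (equivalently a unitary matrix in $\mathcal{M}_{d^2}$); (3) $T$ is an affine combination of unitary conjugations: $T(\rho)=\sum_i\lambda_i U_i\rho U_i^\dagger$ for all $\rho$, with real numbers $\lambda_i$ satisfying $\sum_i\lambda_i=1$ and unitary matrices $U_i\in\mathcal{M}_d$. *)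

(* Defs.v *)
(* Complex numbers are modelled as R[i] for an arbitrary
   R : realType (every realType is a complete archimedean ordered field,
   i.e. a copy of the reals), using mathcomp-real-closed's [complex]. *)
From HB Require Import structures.
From mathcomp Require Import all_boot all_order all_algebra.
From mathcomp Require Import complex.
From mathcomp Require Import reals.

Set Implicit Arguments.
Unset Strict Implicit.
Unset Printing Implicit Defensive.

Import GRing.Theory Num.Theory.
Local Open Scope ring_scope.
Local Open Scope sesquilinear_scope.

Section QC.
Variable C : numClosedFieldType.

Definition adj {m n} (A : 'M[C]_(m, n)) : 'M[C]_(n, m) := A ^t*.

(* A matrix of d x d blocks, i.e. an element of M_n (x) M_d, is positive
   semidefinite: it is Hermitian and its quadratic form
   sum_{i,j} v_i^dagger X_{ij} v_j is >= 0 for every vector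
   v = (v_1,...,v_n) in (C^d)^n. *)
Definition block_psd {n d} (X : 'M['M[C]_d]_n) : Prop :=
  (forall i j, X j i = adj (X i j)) /\
  (forall v : 'I_n -> 'cV[C]_d,
      0 <= (\sum_(i < n) \sum_(j < n) adj (v i) *m X i j *m v j) 0 0).

Definition completely_positive {d} (T : 'M[C]_d -> 'M[C]_d) : Prop :=
  forall n (X : 'M['M[C]_d]_n), block_psd X -> block_psd (map_mx T X).

Definition trace_preserving {d} (T : 'M[C]_d -> 'M[C]_d) : Prop :=
  forall A, \tr (T A) = \tr A.

Definition quantum_channel {d} (T : 'M[C]_d -> 'M[C]_d) : Prop :=
  linear T /\ completely_positive T /\ trace_preserving T.

Definition unital {d} (T : 'M[C]_d -> 'M[C]_d) : Prop := T 1%:M = 1%:M.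

Definition hs_inner {d} (A B : 'M[C]_d) : C := \tr (adj A *m B).

Definition hs_unitary {d} (W : 'M[C]_d -> 'M[C]_d) : Prop :=
  linear W /\ (forall A B, hs_inner (W A) (W B) = hs_inner A B) /\
  (forall B, exists A, W A = B).

Definition hs_convex_unitary {d} (T : 'M[C]_d -> 'M[C]_d) : Prop :=
  exists (k : nat) (p : 'I_k -> C) (W : 'I_k -> 'M[C]_d -> 'M[C]_d),
    (forall a, 0 <= p a) /\ \sum_(a < k) p a = 1 /\
    (forall a, hs_unitary (W a)) /\
    (forall A, T A = \sum_(a < k) p a *: W a A).

Definition affine_unitary_conj {d} (T : 'M[C]_d -> 'M[C]_d) : Prop :=
  exists (k : nat) (lam : 'I_k -> C) (U : 'I_k -> 'M[C]_d),
    (forall i, lam i \is Num.real) /\ \sum_(i < k) lam i = 1 /\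
    (forall i, U i \is unitarymx) /\
    (forall rho, T rho = \sum_(i < k) lam i *: (U i *m rho *m adj (U i))).

End QC.

(* Main.v *)
(* A unital channel satisfies the Kadison-Schwarz inequality
   T(A)^* T(A) <= T(A^* A), so it is a contraction for the Hilbert-Schmidt norm,
   and a contraction K is a mixture of unitaries: diagonalizing K K^* makes the
   rows of K orthogonal of norm at most 1, and each is a mixture of two opposite
   unit vectors. Conversely, if T is a mixture of Hilbert-Schmidt unitaries W_a,
   then sum_a p_a |W_a 1 - 1|^2 = 2 tr 1 - 2 Re tr T(1) = 0, whence T(1) = 1.

   For (1) => (3), let S be the complex span of the maps Ad_U : A |-> U A U^*. It
   is closed under composition. For an orthogonal projection P, averaging Ad_U over
   the unitaries U = 1 + (z - 1) P shows that A |-> P A (1 - P) is in S. Composing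
   such maps with permutations gives A |-> A_ji E_kl for i <> j, k <> l, and
   unitary conjugation then gives A |-> tr(N A) M for all traceless M and N. If T
   is unital and trace preserving then T - id is a sum of maps of this last form.
   As T commutes with adjoints, the coefficients can be replaced by their real
   parts. *)
From HB Require Import structures.
Require Import Defs.
From mathcomp Require Import all_boot all_order all_algebra.
From mathcomp Require Import complex.
From mathcomp Require Import reals.
From mathcomp Require Import perm ring.

Set Implicit Arguments.
Unset Strict Implicit.
Unset Printing Implicit Defensive.

Import Order.TTheory GRing.Theory Num.Theory.
Local Open Scope ring_scope.
Local Open Scope sesquilinear_scope.

(** * Adjoints and unitary matrices *)

Section Adjoint.
Variable C : numClosedFieldType.

Lemma adjmxK m n (A : 'M[C]_(m, n)) : adj (adj A) = A.
Proof. exact: trmxCK. Qed.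

Lemma adjmxM m n p (A : 'M[C]_(m, n)) (B : 'M_(n, p)) :
  adj (A *m B) = adj B *m adj A.
Proof. by rewrite /adj trmx_mul map_mxM. Qed.

Lemma adjmxD m n (A B : 'M[C]_(m, n)) : adj (A + B) = adj A + adj B.
Proof. by rewrite /adj raddfD map_mxD. Qed.

Lemma adjmxN m n (A : 'M[C]_(m, n)) : adj (- A) = - adj A.
Proof. by rewrite /adj raddfN map_mxN. Qed.

Lemma adjmxB m n (A B : 'M[C]_(m, n)) : adj (A - B) = adj A - adj B.
Proof. by rewrite adjmxD adjmxN. Qed.

Lemma adjmxZ m n a (A : 'M[C]_(m, n)) : adj (a *: A) = a^* *: adj A.
Proof. by rewrite /adj linearZ map_mxZ. Qed.

Lemma adjmx0 m n : adj (0 : 'M[C]_(m, n)) = 0.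
Proof. by rewrite /adj raddf0 map_mx0. Qed.

Lemma adjmx1 n : adj (1%:M : 'M[C]_n) = 1%:M.
Proof. by rewrite /adj trmx1 map_mx1. Qed.

Lemma adjmx_sum m n I r (P : pred I) (F : I -> 'M[C]_(m, n)) :
  adj (\sum_(i <- r | P i) F i) = \sum_(i <- r | P i) adj (F i).
Proof. exact: (big_morph _ (@adjmxD m n) (adjmx0 m n)). Qed.

Lemma adjmx_delta m n i j : adj (delta_mx i j : 'M[C]_(m, n)) = delta_mx j i.
Proof. by rewrite /adj trmx_delta map_delta_mx. Qed.

Lemma mxtrace_adj n (A : 'M[C]_n) : \tr (adj A) = (\tr A)^*.
Proof. by rewrite /adj trace_map_mx mxtrace_tr. Qed.

Lemma unitarymx_adjr n (U : 'M[C]_n) : U \is unitarymx -> U *m adj U = 1%:M.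
Proof. by move/unitarymxP. Qed.

Lemma unitarymx_adjl n (U : 'M[C]_n) : U \is unitarymx -> adj U *m U = 1%:M.
Proof. by move/unitarymx_adjr/mulmx1C. Qed.

Lemma unitarymx1 n : (1%:M : 'M[C]_n) \is unitarymx.
Proof. by apply/unitarymxP; rewrite mul1mx; exact: adjmx1. Qed.

Lemma unitarymx_adj n (U : 'M[C]_n) : (adj U \is unitarymx) = (U \is unitarymx).
Proof. exact: trmxC_unitary. Qed.

Lemma perm_mx_unitary n (s : {perm 'I_n}) : (perm_mx s : 'M[C]_n) \is unitarymx.
Proof.
apply/unitarymxP; rewrite tr_perm_mx map_perm_mx -perm_mxM.
by rewrite fingroup.mulgV perm_mx1.
Qed.

(** For an orthogonal projection [P] and [|z| = 1]: the unitary acting as [z] on the range of [P]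
    and as the identity on its orthogonal complement. *)
Definition proj_phase n (z : C) (P : 'M[C]_n) := 1%:M + (z - 1) *: P.

Lemma adj_proj_phase n z (P : 'M[C]_n) :
  adj P = P -> adj (proj_phase z P) = proj_phase z^* P.
Proof. by move=> Ph; rewrite adjmxD adjmx1 adjmxZ Ph rmorphB /= conjC1. Qed.

Lemma proj_phase_unitary n z (P : 'M[C]_n) :
  z * z^* = 1 -> adj P = P -> P *m P = P -> proj_phase z P \is unitarymx.
Proof.
move=> z1 Ph Pp; apply/unitarymxP; rewrite -[_ ^t*]/(adj _) adj_proj_phase //.
rewrite /proj_phase mulmxDl mul1mx mulmxDr mulmx1 -scalemxAl -scalemxAr Pp scalerA.
rewrite -!addrA -[RHS]addr0; congr (_ + _); rewrite -!scalerDl.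
set c := (X in X *: P); suff -> : c = 0 by rewrite scale0r.
by rewrite /c; ring: z1.
Qed.

End Adjoint.

(** * The complex span of unitary conjugations *)

Section ConjSpan.
Variables (C : numClosedFieldType) (d : nat).
Implicit Types (F G : 'M[C]_d -> 'M[C]_d).

Inductive conj_span : ('M[C]_d -> 'M[C]_d) -> Prop :=
| conj_span_unitary U of U \is unitarymx :
    conj_span (fun A => U *m A *m adj U)
| conj_span0 : conj_span (fun=> 0)
| conj_span_lin a F G of conj_span F & conj_span G :
    conj_span (fun A => a *: F A + G A)
| conj_span_ext F G of F =1 G & conj_span F : conj_span G.

Lemma conj_span_comp F G :
  conj_span F -> conj_span G -> conj_span (fun A => F (G A)).
Proof.
move=> sF sG; elim: sF => {F}.
- move=> U Uu; elim: sG => {G}.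
  + move=> V Vu; apply: conj_span_ext (conj_span_unitary (mul_unitarymx Uu Vu)).
    by move=> A; rewrite adjmxM !mulmxA.
  + by apply: conj_span_ext conj_span0 => A; rewrite mulmx0 mul0mx.
  + move=> a F G _ IHF _ IHG; apply: conj_span_ext (conj_span_lin a IHF IHG).
    by move=> A /=; rewrite mulmxDr mulmxDl -scalemxAr -scalemxAl.
  + move=> F G eqFG _; by apply: conj_span_ext => A /=; rewrite eqFG.
- exact: conj_span0.
- by move=> a F F' _ IHF _ IHF'; apply: conj_span_lin.
- by move=> F F' eqF _; apply: conj_span_ext => A.
Qed.

Lemma conj_spanZ a F : conj_span F -> conj_span (fun A => a *: F A).
Proof.
move=> sF; apply: conj_span_ext (conj_span_lin a sF conj_span0) => A.
by rewrite addr0.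
Qed.

Lemma conj_spanD F G :
  conj_span F -> conj_span G -> conj_span (fun A => F A + G A).
Proof.
move=> sF sG; apply: conj_span_ext (conj_span_lin 1 sF sG) => A.
by rewrite scale1r.
Qed.

Lemma conj_span_sum I (r : seq I) (F : I -> 'M[C]_d -> 'M[C]_d) :
  (forall i, conj_span (F i)) -> conj_span (fun A => \sum_(i <- r) F i A).
Proof.
move=> sF; elim: r => [|i r IHr].
  by apply: conj_span_ext conj_span0 => A; rewrite big_nil.
by apply: conj_span_ext (conj_spanD (sF i) IHr) => A; rewrite big_cons.
Qed.

Lemma conj_span_seq F : conj_span F ->
  exists2 s : seq (C * 'M[C]_d), all (fun x => x.2 \is unitarymx) s &
    forall A, F A = \sum_(x <- s) x.1 *: (x.2 *m A *m adj x.2).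
Proof.
elim=> {F} [U Uu||a F G _ [s su sE] _ [t tu tE]|F G eqFG _ [s su sE]].
- exists [:: (1, U)] => [|A]; first by rewrite /= Uu.
  by rewrite big_seq1 scale1r.
- by exists [::] => // A; rewrite big_nil.
- exists ([seq (a * x.1, x.2) | x <- s] ++ t) => [|A].
    by rewrite all_cat all_map tu andbT.
  rewrite sE tE big_cat big_map scaler_sumr /=; congr (_ + _).
  by apply: eq_bigr => x _; rewrite scalerA.
- by exists s => // A; rewrite -eqFG.
Qed.

(* Averaging [z^* Ad(1 + (z - 1) P)] over the fourth roots of unity [z] kills
   every term of the expansion except the one linear in [z]. *)
Lemma conj_span_offdiag (P : 'M[C]_d) :
  adj P = P -> P *m P = P -> conj_span (fun A => P *m A *m (1%:M - P)).
Proof.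
move=> Ph Pp.
have sP z : z * z^* = 1 ->
    conj_span (fun A => (z^* / 4%:R) *: (proj_phase z P *m A *m proj_phase z^* P)).
  move=> z1; apply: conj_spanZ.
  apply: conj_span_ext (conj_span_unitary (proj_phase_unitary z1 Ph Pp)) => A.
  by rewrite adj_proj_phase.
have z1 : 1 * 1^* = 1 :> C by rewrite conjC1 mulr1.
have z2 : -1 * (-1)^* = 1 :> C by rewrite rmorphN1 mulrNN mulr1.
have z3 : 'i * 'i^* = 1 :> C by rewrite conjCi mulrN -expr2 sqrCi opprK.
have z4 : - 'i * (- 'i)^* = 1 :> C by rewrite rmorphN mulrNN.
apply: conj_span_ext (conj_spanD (conj_spanD (sP _ z1) (sP _ z2))
                                 (conj_spanD (sP _ z3) (sP _ z4))) => A.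
have i2 : 'i * 'i = -1 :> C by rewrite -expr2 sqrCi.
rewrite !rmorphN /= !conjC1 !conjCi opprK /proj_phase.
rewrite !(mulmxDl, mulmxDr, mul1mx, mulmx1, mulmxN) -!(scalemxAl, scalemxAr).
move: (P *m A) (A *m P) (P *m A *m P) => X Y Z.
apply/matrixP => i j; by rewrite !mxE; field: i2.
Qed.

(** Conjugating an off-diagonal matrix unit by a suitable phase unitary produces differences of
    diagonal units, and these together with the off-diagonal units span the traceless matrices. *)
Lemma traceless_ind n (V : 'M[C]_n -> Prop) :
  V 0 -> (forall a M N, V M -> V N -> V (a *: M + N)) ->
  (forall U M, U \is unitarymx -> V M -> V (U *m M *m adj U)) ->
  (forall i j, i != j -> V (delta_mx i j)) ->
  forall M, \tr M = 0 -> V M.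
Proof.
move=> V0 Vlin Vconj Vdelta.
have VD M N : V M -> V N -> V (M + N) by rewrite -{2}[M]scale1r; apply: Vlin.
have VZ a M : V M -> V (a *: M) by rewrite -[_ *: _]addr0 => VM; apply: Vlin.
have Vsum I (r : seq I) (F : I -> 'M[C]_n) :
    (forall i, V (F i)) -> V (\sum_(i <- r) F i).
  by move=> VF; elim/big_rec: _ => // i M _; apply: VD.
have Vdiff i j : V (delta_mx i i - delta_mx j j).
  have [->|ij] := eqVneq i j; first by rewrite subrr.
  have ji : j != i by rewrite eq_sym.
  pose E k l : 'M[C]_n := delta_mx k l.
  have EM k l k' l' : E k l *m E k' l' = (l == k')%:R *: E k l'.
    by rewrite mul_delta_mx_cond scaler_nat.
  (* The projection onto the line spanned by [e_i + e_j]. *)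
  pose P := 2%:R^-1 *: (E i i + E i j + E j i + E j j).
  have Ph : adj P = P.
    rewrite /P adjmxZ !adjmxD !adjmx_delta; congr (_ *: _).
      by rewrite fmorphV rmorph_nat.
    by rewrite -!addrA; congr (_ + _); rewrite addrCA.
  have Pp : P *m P = P.
    rewrite /P -scalemxAl -scalemxAr !(mulmxDl, mulmxDr) !EM !eqxx.
    rewrite (negPf ij) (negPf ji) !scale1r !scale0r.
    move: (E i i) (E i j) (E j i) (E j j) => E1 E2 E3 E4.
    apply/matrixP=> k l; by rewrite !mxE; field.
  have i2 : 'i * 'i = -1 :> C by rewrite -expr2 sqrCi.
  have z1 : 'i * 'i^* = 1 :> C by rewrite conjCi mulrN i2 opprK.
  have := Vconj _ _ (proj_phase_unitary z1 Ph Pp) (Vdelta _ _ ij).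
  rewrite adj_proj_phase // conjCi => VX.
  (* With [U = proj_phase 'i P], one has [2 U E_ij U^* = E_ij + E_ji - 'i (E_ii - E_jj)];
     multiplying by ['i] and cancelling the off-diagonal terms leaves [E_ii - E_jj]. *)
  have := VD _ _ (VZ (2%:R * 'i) _ VX)
                 (VD _ _ (VZ (- 'i) _ (Vdelta _ _ ij)) (VZ (- 'i) _ (Vdelta _ _ ji))).
  congr V; rewrite /proj_phase /P -/(E i j) -/(E j i) -/(E i i) -/(E j j).
  rewrite !(mulmxDl, mulmxDr, mul1mx, mulmx1) -!(scalemxAl, scalemxAr).
  rewrite !(mulmxDl, mulmxDr) !EM !eqxx ?(negPf ij) ?(negPf ji).
  rewrite !(scale0r, scale1r, addr0, add0r) ?(mulmxDl, mulmxDr) ?EM ?eqxx.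
  rewrite ?(negPf ij) ?(negPf ji) ?(scale0r, scale1r, mul0mx, addr0, add0r).
  move: (E i i) (E i j) (E j i) (E j j) => E1 E2 E3 E4.
  apply/matrixP=> k l; by rewrite !mxE; field: i2.
case: n => [|n] in V V0 Vlin Vconj Vdelta VD VZ Vsum Vdiff * => M trM.
  by rewrite flatmx0.
(* The corrections by [delta_mx 0 0] add up to [\tr M *: delta_mx 0 0], which is zero. *)
have -> : M = \sum_i \sum_j (if i == j then M i i *: (delta_mx i i - delta_mx 0 0)
                            else M i j *: delta_mx i j).
  transitivity (\sum_i \sum_j M i j *: delta_mx i j -
                \sum_i \sum_(j | j == i) M i i *: delta_mx 0 0 : 'M_n.+1).
    rewrite -matrix_sum_delta; under [X in _ - X]eq_bigr do rewrite big_pred1_eq.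
    by rewrite -scaler_suml -[\sum_i _]/(\tr M) trM scale0r subr0.
  rewrite -sumrB; apply: eq_bigr => i _; rewrite [X in _ - X]big_mkcond /= -sumrB.
  apply: eq_bigr => j _; rewrite eq_sym; case: eqVneq => [->|_].
    by rewrite scalerBr.
  by rewrite subr0.
apply: (Vsum) => i; apply: Vsum => j; case: eqVneq => [_|ij]; apply: VZ => //.
exact: Vdelta.
Qed.

Lemma perm2P (T : finType) (i j k l : T) :
  i != j -> k != l -> exists s : {perm T}, s k = i /\ s l = j.
Proof.
move=> ij kl; pose t := tperm k i.
exists (t * tperm (t l) j)%g; rewrite !permM tpermL tpermL; split=> //.
rewrite tpermD //; last by rewrite eq_sym.
by rewrite -(tpermL k i) -/t (inj_eq perm_inj) eq_sym.
Qed.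

Lemma delta_mulmx_delta m n p q (A : 'M[C]_(m, n)) (k : 'I_p) i j (l : 'I_q) :
  delta_mx k i *m A *m delta_mx j l = A i j *: delta_mx k l.
Proof.
apply/matrixP=> x y; rewrite !mxE (bigD1 j) //= big1 ?addr0 => [|j' jj']; last first.
  by rewrite !mxE (negPf jj') mulr0.
rewrite !mxE (bigD1 i) //= big1 ?addr0 => [|i' ii']; last first.
  by rewrite !mxE (negPf ii') andbF mul0r.
by rewrite !mxE !eqxx andbT; case: (x == k); rewrite /= ?mul1r ?mul0r ?mulr0.
Qed.

Lemma mxtrace_delta_mul n (A : 'M[C]_n) i j : \tr (delta_mx i j *m A) = A j i.
Proof.
rewrite /mxtrace (bigD1 i) //= big1 ?addr0 => [|k ki]; last first.
  by rewrite mxE big1 // => l _; rewrite !mxE (negPf ki) mul0r.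
rewrite mxE (bigD1 j) //= big1 ?addr0 => [|k kj]; last first.
  by rewrite !mxE (negPf kj) andbF mul0r.
by rewrite !mxE !eqxx mul1r.
Qed.

(** Conjugating [N] precomposes the map with a conjugation and conjugating [M] postcomposes it, so
    two uses of [traceless_ind] leave only off-diagonal matrix units. *)
Lemma conj_span_rank1 (M N : 'M[C]_d) :
  \tr M = 0 -> \tr N = 0 -> conj_span (fun A => \tr (N *m A) *: M).
Proof.
move=> trM0; move: N; apply: traceless_ind => [|a N N' sN sN'|U N Uu sN|i j ij].
- by apply: conj_span_ext conj_span0 => A; rewrite mul0mx mxtrace0 scale0r.
- apply: conj_span_ext (conj_span_lin a sN sN') => A.
  by rewrite mulmxDl -scalemxAl mxtraceD mxtraceZ scalerDl scalerA.
- move: (Uu); rewrite -unitarymx_adj => /conj_span_unitary/(conj_span_comp sN).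
  apply: conj_span_ext => A; rewrite adjmxK; congr (_ *: _).
  by rewrite !mulmxA mxtrace_mulC !mulmxA.
move: M trM0; apply: traceless_ind => [|a M M' sM sM'|U M Uu sM|k l kl].
- by apply: conj_span_ext conj_span0 => A; rewrite scaler0.
- apply: conj_span_ext (conj_span_lin a sM sM') => A.
  by rewrite scalerDr !scalerA mulrC.
- apply: conj_span_ext (conj_span_comp (conj_span_unitary Uu) sM) => A.
  by rewrite -scalemxAr -scalemxAl.
have ji : j != i by rewrite eq_sym.
have [s [sk sl]] := perm2P ji kl.
have Ep m : delta_mx m m *m delta_mx m m = delta_mx m m :> 'M[C]_d.
  exact: mul_delta_mx.
have Eh m : adj (delta_mx m m) = delta_mx m m :> 'M[C]_d by exact: adjmx_delta.
have Qh : adj (1%:M - delta_mx i i) = 1%:M - delta_mx i i :> 'M[C]_d.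
  by rewrite adjmxB adjmx1 Eh.
have Qp : (1%:M - delta_mx i i) *m (1%:M - delta_mx i i)
           = 1%:M - delta_mx i i :> 'M[C]_d.
  by rewrite mulmxBr mulmx1 mulmxBl mul1mx Ep subrr subr0.
(* As [i != j], the two cuts compose to [E_jj A E_ii], that is [A j i *: delta_mx j i]; [perm_mx s]
   then moves this entry to position [(k, l)]. *)
apply: conj_span_ext
  (conj_span_comp (conj_span_unitary (perm_mx_unitary C s))
    (conj_span_comp (conj_span_offdiag Qh Qp)
                    (conj_span_offdiag (Eh j) (Ep j)))) => A.
have -> : (1%:M - (1%:M - delta_mx i i)) = delta_mx i i :> 'M[C]_d.
  by rewrite opprB addrC subrK.
have -> : (1%:M - delta_mx i i) *m (delta_mx j j *m A *m (1%:M - delta_mx j j))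
            *m delta_mx i i = delta_mx j j *m A *m delta_mx i i.
  rewrite !mulmxA mulmxBl mul1mx mul_delta_mx_0 // subr0 -!mulmxA; congr (_ *m _).
  by rewrite mulmxBl mul1mx mul_delta_mx_0 1?eq_sym // subr0.
have WE m (D := delta_mx (s m) (s m)) :
    perm_mx s *m D = delta_mx m (s m) :> 'M[C]_d.
  rewrite -row_permE; apply/matrixP=> x y; rewrite !mxE.
  by rewrite (inj_eq perm_inj).
rewrite -sk -sl !mulmxA WE -!mulmxA -[X in _ *m (_ *m X)]adjmxK adjmxM adjmxK Eh WE.
rewrite adjmx_delta; by rewrite mxtrace_delta_mul mulmxA delta_mulmx_delta sk sl.
Qed.

End ConjSpan.

(** * Real affine combinations of unitary conjugations *)

Section AffineCombination.
Variables (C : numClosedFieldType) (d : nat).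

(* Since [T - id] kills [1] and has traceless values, the matrix units dual to
   the [delta_mx k l] may be replaced by their traceless parts. *)
Lemma conj_span_unital_tp (T : {linear 'M[C]_d -> 'M[C]_d}) :
  unital T -> trace_preserving T -> conj_span T.
Proof.
move=> T1 trT.
pose N k l : 'M[C]_d := delta_mx l k - (d%:R^-1 * (k == l)%:R) *: 1%:M.
pose X k l := T (delta_mx k l) - delta_mx k l.
have trN k l : \tr (N k l) = 0.
  have d0 : d%:R != 0 :> C.
    by rewrite pnatr_eq0 -lt0n; apply: leq_ltn_trans (ltn_ord k).
  rewrite raddfB /= mxtraceZ mxtrace1 mulrAC mulVf // mul1r.
  by rewrite -[delta_mx l k]mulmx1 mxtrace_delta_mul mxE subrr.
have trX k l : \tr (X k l) = 0 by rewrite raddfB /= trT subrr.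
have sX k l := conj_span_rank1 (trX k l) (trN k l).
apply: conj_span_ext
  (conj_spanD (conj_span_unitary (unitarymx1 C d))
    (conj_span_sum (index_enum _) (fun k =>
      conj_span_sum (index_enum _) (fun l => sX k l)))) => A /=.
rewrite mul1mx adjmx1 mulmx1.
have trNA k l : \tr (N k l *m A) = A k l - d%:R^-1 * (k == l)%:R * \tr A.
  by rewrite mulmxBl raddfB /= mxtrace_delta_mul -scalemxAl mul1mx mxtraceZ.
under eq_bigr do under eq_bigr do rewrite trNA scalerBl.
under eq_bigr do rewrite sumrB; rewrite sumrB.
have -> : \sum_k \sum_l A k l *: X k l = T A - A.
  rewrite {2 3}[A]matrix_sum_delta linear_sum -sumrB; apply: eq_bigr => k _.
  rewrite linear_sum -sumrB; apply: eq_bigr => l _.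
  by rewrite linearZ /= scalerBr.
(* The trace parts contribute a multiple of [\sum_k X k k = T 1 - 1], which vanishes by
   unitality. *)
have -> : \sum_k \sum_l (d%:R^-1 * (k == l)%:R * \tr A) *: X k l
          = (d%:R^-1 * \tr A) *: \sum_k X k k.
  rewrite scaler_sumr; apply: eq_bigr => k _.
  rewrite (bigD1 k) //= eqxx mulr1 big1 ?addr0 // => l lk.
  by rewrite eq_sym (negPf lk) mulr0 mul0r scale0r.
by rewrite sumrB -linear_sum -mx1_sum_delta T1 subrr scaler0 subr0 addrC subrK.
Qed.

Lemma conj_span_affine (T : 'M[C]_d -> 'M[C]_d) :
  conj_span T -> (forall A, T (adj A) = adj (T A)) -> unital T ->
  affine_unitary_conj T.
Proof.
move=> /conj_span_seq[s /allP su sE] Tadj T1.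
pose x i := tnth (in_tuple s) i; pose lam i := ((x i).1 + (x i).1^*) / 2%:R.
have xu i : (x i).2 \is unitarymx by apply/su/mem_tnth.
have xE A : T A = \sum_i (x i).1 *: ((x i).2 *m A *m adj (x i).2).
  by rewrite sE big_tnth.
have TE A : T A = \sum_i lam i *: ((x i).2 *m A *m adj (x i).2).
  (* Conjugations commute with [adj], so averaging [T] with [adj \o T \o adj], again [T], only
     replaces each coefficient by its real part. *)
  have -> : T A = 2%:R^-1 *: (T A + adj (T (adj A))).
    rewrite Tadj adjmxK -mulr2n -scaler_nat scalerA mulVf ?scale1r //.
    by rewrite pnatr_eq0.
  rewrite !xE adjmx_sum -big_split scaler_sumr; apply: eq_bigr => i _ /=.
  rewrite adjmxZ !adjmxM !adjmxK mulmxA -scalerDl scalerA; congr (_ *: _).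
  by rewrite mulrC.
have lam_real i : lam i \is Num.real.
  apply/CrealP; rewrite /lam rmorphM rmorphD /= conjCK fmorphV rmorph_nat.
  by rewrite addrC.
(* In dimension zero [T 1 = 1] says nothing about the sum of the [lam i]; all matrices being equal
   there, one identity conjugation of weight 1 serves. *)
have [d0|d_gt0] := posnP d.
  exists 1%N, (fun=> 1), (fun=> 1%:M); split=> [i|]; first exact: real1.
  rewrite big_ord1; do !split; first by move=> _; apply: unitarymx1.
  move=> A; apply/matrixP=> i; suff: (i < 0)%N by [].
  by rewrite -d0 ltn_ord.
exists (size s), lam, (fun i => (x i).2); do !split=> //.
move: T1; rewrite /unital TE.
under eq_bigr do rewrite mulmx1 unitarymx_adjr //.
rewrite -scaler_suml => /matrixP/(_ (Ordinal d_gt0) (Ordinal d_gt0)).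
by rewrite !mxE eqxx mulr1.
Qed.

Lemma affine_unitary_conj_unital (T : 'M[C]_d -> 'M[C]_d) :
  affine_unitary_conj T -> unital T.
Proof.
move=> [k [lam [U [_ [lam1 [Uu TE]]]]]]; rewrite /unital TE.
under eq_bigr do rewrite mulmx1 unitarymx_adjr //.
by rewrite -scaler_suml lam1 scale1r.
Qed.

End AffineCombination.

(** * Convex combinations of Hilbert-Schmidt unitaries *)

Section HilbertSchmidt.
Variable C : numClosedFieldType.

Local Notation "''[' u , v ]" := ((u *m adj v) 0 0) : ring_scope.

Lemma dot_gt0 n (u : 'rV[C]_n) : u != 0 -> 0 < '[u, u].
Proof. by move/dotmx_is_dotmx; rewrite dotmxE. Qed.

Lemma dot_ge0 n (u : 'rV[C]_n) : 0 <= '[u, u].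
Proof.
have [->|/dot_gt0/ltW//] := eqVneq u 0.
by rewrite mul0mx mxE.
Qed.

Lemma dot_normalize n (w : 'rV[C]_n) : w != 0 ->
  let c := sqrtC '[w, w] in 0 < c /\ '[c^-1 *: w, c^-1 *: w] = 1.
Proof.
move=> /dot_gt0 w0 c; have c0 : 0 < c by rewrite sqrtC_gt0.
split=> //; rewrite adjmxZ -scalemxAl -scalemxAr scalerA mxE.
have /CrealP-> : c^-1 \is Num.real by rewrite rpredV gtr0_real.
by rewrite -expr2 exprVn sqrtCK mulVf // gt_eqF.
Qed.

Lemma mulmx_adj_row m n p (A : 'M[C]_(m, n)) (B : 'M_(p, n)) i j :
  (A *m adj B) i j = '[row i A, row j B].
Proof. by rewrite !mxE; apply: eq_bigr => k _; rewrite !mxE. Qed.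

(** The arguments swap because [hs_inner] is conjugate-linear in its first argument and the row form
    in its second. *)
Lemma hs_innerE d (A B : 'M[C]_d) : hs_inner A B = '[mxvec B, mxvec A].
Proof.
rewrite /hs_inner mxtrace_mulC /mxtrace; under eq_bigr do rewrite mxE.
rewrite pair_bigA /= mxE (reindex _ (curry_mxvec_bij _ _)).
by apply: eq_bigr => [[i j] _]; rewrite /= !mxE !mxvecE.
Qed.

Lemma hs_inner_ge0 d (A : 'M[C]_d) : 0 <= hs_inner A A.
Proof. by rewrite hs_innerE dot_ge0. Qed.

Lemma hs_inner_eq0 d (A : 'M[C]_d) : hs_inner A A = 0 -> A = 0.
Proof.
rewrite hs_innerE => A0; apply/eqP; rewrite -mxvec_eq0; apply/eqP.
by apply: contra_eq A0 => /dot_gt0 /gt_eqF ->.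
Qed.

Lemma hs_convex_unitary_unital d (T : 'M[C]_d -> 'M[C]_d) :
  trace_preserving T -> hs_convex_unitary T -> unital T.
Proof.
move=> trT [k [p [W [p0 [p1 [Wu TE]]]]]].
pose X a := W a 1%:M - 1%:M.
have XE a : hs_inner (X a) (X a) =
    \tr (1%:M : 'M[C]_d) + \tr (1%:M : 'M[C]_d) - (\tr (W a 1%:M))^* - \tr (W a 1%:M).
  have [_ [/(_ 1%:M 1%:M) + _]] := Wu a; rewrite /hs_inner /X.
  rewrite adjmx1 mulmx1 adjmxB adjmx1 mulmxBl mulmxBr !mulmx1 mul1mx !raddfB /=.
  by rewrite mxtrace_adj => ->; ring.
have trT1 : \sum_a p a * \tr (W a 1%:M) = \tr (1%:M : 'M[C]_d).
  by rewrite -trT TE raddf_sum; apply: eq_bigr => a _ /=; rewrite mxtraceZ.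
have trT1C : \sum_a p a * (\tr (W a 1%:M))^* = \tr (1%:M : 'M[C]_d).
  rewrite -[RHS]conjCK -mxtrace_adj adjmx1 -trT1 rmorph_sum.
  apply: eq_bigr => a _ /=; rewrite rmorphM /=; congr (_ * _).
  by apply/esym/CrealP/ger0_real.
have sumX : \sum_a p a * hs_inner (X a) (X a) = 0.
  under eq_bigr do rewrite XE !mulrBr; rewrite !sumrB trT1 trT1C -mulr_suml p1.
  by rewrite mul1r addrK subrr.
(* Nonnegative terms with zero sum vanish: either [p a = 0] or [W a] fixes [1]. *)
have pX a : p a *: X a = 0.
  have /eqP := sumX; rewrite psumr_eq0 => [/allP/(_ a (mem_index_enum _))|i _].
    rewrite /= mulf_eq0 => /orP[/eqP->|/eqP/hs_inner_eq0->].
      by rewrite scale0r.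
    by rewrite scaler0.
  by rewrite mulr_ge0 ?hs_inner_ge0.
apply/eqP; rewrite -subr_eq0 TE -[1%:M in X in _ - X]scale1r -p1 scaler_suml -sumrB.
by apply/eqP/big1 => a _; rewrite -scalerBr p1; exact: pX.
Qed.

(** The convex hull of the unitary group, generated by two-point mixtures. *)
Inductive unitary_hull n : 'M[C]_n -> Prop :=
| unitary_hull_unitary U of U \is unitarymx : unitary_hull U
| unitary_hull_mix p q A B of 0 <= p & 0 <= q & p + q = 1 &
    unitary_hull A & unitary_hull B : unitary_hull (p *: A + q *: B).

Lemma unitary_hull_mulmx n (U A : 'M[C]_n) :
  U \is unitarymx -> unitary_hull A -> unitary_hull (U *m A).
Proof.
move=> Uu; elim=> {A} [V Vu|p q A B p0 q0 pq _ IHA _ IHB].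
  exact/unitary_hull_unitary/mul_unitarymx.
by rewrite mulmxDr -!scalemxAr; apply: unitary_hull_mix.
Qed.

Lemma unitary_hull_seq n (A : 'M[C]_n) : unitary_hull A ->
  exists s : seq (C * 'M[C]_n),
    [/\ forall x, x \in s -> 0 <= x.1 /\ x.2 \is unitarymx,
        \sum_(x <- s) x.1 = 1 & A = \sum_(x <- s) x.1 *: x.2].
Proof.
elim=> {A} [U Uu|p q A B p0 q0 pq _ [s [sP s1 ->]] _ [t [tP t1 ->]]].
  exists [:: (1, U)]; rewrite !big_seq1 scale1r; split=> // x.
  by rewrite inE => /eqP->.
exists ([seq (p * x.1, x.2) | x <- s] ++ [seq (q * x.1, x.2) | x <- t]); split.
- move=> x; rewrite mem_cat => /orP[] /mapP[y yin ->] /=.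
    by have [y0 yu] := sP _ yin; rewrite mulr_ge0.
  by have [y0 yu] := tP _ yin; rewrite mulr_ge0.
- by rewrite big_cat !big_map /= -!mulr_sumr s1 t1 !mulr1.
rewrite big_cat !big_map /= !scaler_sumr.
by congr (_ + _); apply: eq_bigr => x _; rewrite scalerA.
Qed.

(** Supplies the unit vector along which row [i] is to be lengthened, also when that row is zero and
    has no direction of its own. *)
Lemma row_dir n (B : 'M[C]_n) i :
  (forall j, j != i -> '[row i B, row j B] = 0) -> '[row i B, row i B] <= 1 ->
  exists (u : 'rV_n) (s : C), [/\ '[u, u] = 1, 0 <= s, s <= 1, row i B = s *: u &
    forall j, j != i -> '[u, row j B] = 0].
Proof.
move=> orthB B1; have [b0|b_neq0] := eqVneq (row i B) 0.
  (* A zero row makes [adj B] singular; a nonzero vector in its left kernel is orthogonal to every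
     row of [B]. *)
  have /rowV0Pn[w /sub_kermxP wB w0] : kermx (adj B) != 0.
    rewrite kermx_eq0 row_free_unit; apply/negP => Bu.
    have : adj B *m delta_mx i (0 : 'I_1) = 0.
      by rewrite -[LHS]adjmxK adjmxM adjmxK adjmx_delta -rowE b0 adjmx0.
    move/(congr1 (mulmx (invmx (adj B)))); rewrite mulKmx // mulmx0.
    move/matrixP/(_ i 0)/eqP; rewrite !mxE !eqxx.
    by rewrite oner_eq0.
  have [_ u1] := dot_normalize w0.
  exists ((sqrtC '[w, w])^-1 *: w), 0; split=> // [|j _].
    by rewrite scale0r.
  rewrite -scalemxAl mxE.
  have -> : '[w, row j B] = (w *m adj B) 0 j.
    by rewrite -[in LHS](row_id 0 w) -mulmx_adj_row.
  by rewrite wB [X in _ * X]mxE mulr0.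
have [c0 u1] := dot_normalize b_neq0; set c := sqrtC _ in c0 u1.
exists (c^-1 *: row i B), c; split=> // [|||j ji].
- exact: ltW.
- rewrite -(@ler_pXn2r _ 2) ?nnegrE ?ler01 ?(ltW c0) //.
  by rewrite sqrtCK expr1n.
- by rewrite scalerA divff ?scale1r // gt_eqF.
by rewrite -scalemxAl mxE orthB // mulr0.
Qed.

(* Induction on the number of rows not yet known to be unit vectors: a row
   [s u] with [u] of norm one is a mixture of [u] and [- u]. *)
Lemma unitary_hull_orthorows n m (B : 'M[C]_n) :
  (forall i j, i != j -> '[row i B, row j B] = 0) ->
  (forall i, '[row i B, row i B] <= 1) ->
  (forall i : 'I_n, (m <= i)%N -> '[row i B, row i B] = 1) ->
  unitary_hull B.
Proof.
elim: m B => [|m IHm] B orthB leB eqB.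
  apply/unitary_hull_unitary/unitarymxP; apply/matrixP=> i j.
  rewrite [LHS]mulmx_adj_row [RHS]mxE; have [->|ij] := eqVneq i j; first exact: eqB.
  exact: orthB.
have [lt_mn|le_nm] := ltnP m n; last first.
  by apply: IHm => // i le_mi; have := leq_trans le_nm le_mi; rewrite leqNgt ltn_ord.
pose i := Ordinal lt_mn.
have [|u [s [u1 s0 s1 Bi orthu]]] := @row_dir _ B i _ (leB i).
  by move=> j ji; apply: orthB; rewrite eq_sym.
pose B' (v : 'rV_n) := \matrix_(k < n) (if k == i then v else row k B).
have rowB' v k : row k (B' v) = if k == i then v else row k B by rewrite rowK.
have hullB' v : '[v, v] = 1 -> (forall j, j != i -> '[v, row j B] = 0) ->
    unitary_hull (B' v).
  move=> v1 orthv; apply: IHm => [k l kl|k|k le_mk]; rewrite !rowB'.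
  - case: (eqVneq k i) => [ki|ki].
      by rewrite -ki eq_sym (negPf kl); apply: orthv; rewrite -ki eq_sym.
    case: (eqVneq l i) => [li|li]; last exact: orthB.
    rewrite -[_ *m _]adjmxK adjmxM adjmxK mxE mxE orthv //.
    by rewrite conjC0.
  - by case: ifP => // _; rewrite v1.
  - case: eqVneq => // ki; apply: eqB; rewrite ltn_neqAle le_mk andbT.
    by apply: contra_neq ki => mk; apply: val_inj.
(* The weights differ by [s], which restores row [i], and sum to 1, which keeps the other rows. *)
have -> : B = ((1 + s) / 2%:R) *: B' u + ((1 - s) / 2%:R) *: B' (- u).
  apply/row_matrixP=> k; rewrite linearD !linearZ /= !rowB'.
  case: eqVneq => [->|_]; last first.
    rewrite -scalerDl -mulrDl addrACA subrr addr0 -mulr2n divff ?scale1r //.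
    by rewrite pnatr_eq0.
  by rewrite Bi scalerN -scalerBl; congr (_ *: _); field.
apply: unitary_hull_mix.
- by rewrite divr_ge0 ?ler0n // addr_ge0 ?ler01.
- by rewrite divr_ge0 ?ler0n // subr_ge0.
- by field.
- exact: hullB'.
apply: hullB' => [|j ji]; first by rewrite adjmxN mulNmx mulmxN opprK.
by rewrite mulNmx mxE orthu // oppr0.
Qed.

Lemma unitary_hull_contraction n (K : 'M[C]_n) :
  (forall x : 'rV_n, '[x *m K, x *m K] <= '[x, x]) -> unitary_hull K.
Proof.
move=> Kle; pose H := K *m adj K.
have Hn : H \is normalmx.
  by apply/normalmxP; rewrite -[_ ^t*]/(adj _) /H adjmxM adjmxK.
have /orthomx_spectralP := Hn.
have := spectral_unitarymx H; set P := spectralmx H => Pu.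
rewrite (invmx_unitary Pu) -[_ ^t*]/(adj _); move: (spectral_diag H) => D HE.
(* The Gram matrix of the rows of [P *m K] is diagonal, and each row is the image under [K] of a
   unit vector. *)
have -> : K = adj P *m (P *m K) by rewrite mulmxA unitarymx_adjl ?mul1mx.
apply: unitary_hull_mulmx; first by rewrite unitarymx_adj.
have GE : P *m K *m adj (P *m K) = diag_mx D.
  rewrite adjmxM mulmxA -[P *m K *m _]mulmxA -/H HE !mulmxA unitarymx_adjr //.
  by rewrite mul1mx -mulmxA unitarymx_adjr ?mulmx1.
apply: (@unitary_hull_orthorows _ n) => [i j ij|i|i].
- by rewrite -mulmx_adj_row GE mxE (negPf ij).
- rewrite row_mul (le_trans (Kle _)) // -mulmx_adj_row unitarymx_adjr //.
  by rewrite mxE eqxx.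
- by rewrite leqNgt ltn_ord.
Qed.

(** [mxvec] identifies the Hilbert-Schmidt space isometrically with row vectors, on which [T] acts
    as right multiplication by [lin_mx T]. *)
Lemma hs_convex_unitary_contraction d (T : {linear 'M[C]_d -> 'M[C]_d}) :
  (forall A, hs_inner (T A) (T A) <= hs_inner A A) -> hs_convex_unitary T.
Proof.
move=> Tle.
have /unitary_hull_seq[s [sP s1 sE]] : unitary_hull (lin_mx T).
  apply: unitary_hull_contraction => x.
  by rewrite mul_rV_lin -hs_innerE -{3 4}[x]vec_mxK -hs_innerE.
pose x i := tnth (in_tuple s) i.
have xP i : 0 <= (x i).1 /\ (x i).2 \is unitarymx by apply/sP/mem_tnth.
exists (size s), (fun i => (x i).1), (fun i A => vec_mx (mxvec A *m (x i).2)).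
split=> [i|]; first by case: (xP i).
split; first by rewrite -[RHS]s1 [in RHS]big_tnth.
split=> [i|A]; last first.
  rewrite -(mx_vec_lin T) sE mulmx_sumr linear_sum big_tnth.
  by apply: eq_bigr => i _; rewrite -scalemxAr linearZ.
have [_ xu] := xP i; split.
  by move=> a A B; rewrite !linearP mulmxDl -scalemxAl linearP.
split=> [A B|B].
  rewrite !hs_innerE !vec_mxK adjmxM -mulmxA (mulmxA _ (adj _)).
  by rewrite unitarymx_adjr ?mul1mx.
exists (vec_mx (mxvec B *m adj (x i).2)).
by rewrite vec_mxK -mulmxA unitarymx_adjl ?mulmx1 ?mxvecK.
Qed.

End HilbertSchmidt.

(** * The Kadison-Schwarz inequality and contractivity *)

Section KadisonSchwarz.
Variables (C : numClosedFieldType) (d : nat).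

Lemma adj_mul_ge0 n (v : 'cV[C]_n) : 0 <= (adj v *m v) 0 0.
Proof. by have := dot_ge0 (adj v); rewrite adjmxK. Qed.

(** The quadratic form at [v] is the squared norm of [\sum_i B i *m v i]. *)
Lemma gram_block_psd n (B : 'I_n -> 'M[C]_d) :
  block_psd (\matrix_(i, j) (adj (B i) *m B j)).
Proof.
split=> [i j|v]; first by rewrite !mxE adjmxM adjmxK.
have -> : \sum_i \sum_j adj (v i) *m (\matrix_(i, j) (adj (B i) *m B j)) i j *m v j
          = adj (\sum_i B i *m v i) *m (\sum_j B j *m v j).
  rewrite adjmx_sum mulmx_suml; apply: eq_bigr => i _; rewrite mulmx_sumr.
  by apply: eq_bigr => j _; rewrite mxE adjmxM !mulmxA.
exact: adj_mul_ge0.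
Qed.

Variable T : {linear 'M[C]_d -> 'M[C]_d}.
Hypothesis cpT : completely_positive T.

Lemma completely_positive_gram n (B : 'I_n -> 'M[C]_d) (v : 'I_n -> 'cV_d) :
  0 <= (\sum_i \sum_j adj (v i) *m T (adj (B i) *m B j) *m v j) 0 0.
Proof.
have [_ /(_ v)] := cpT (gram_block_psd B).
by under eq_bigr do under eq_bigr do rewrite !mxE.
Qed.

(** The image under [T] of the Gram matrix of the pair [(A, 1)] is Hermitian; its off-diagonal
    blocks are compared. *)
Lemma completely_positive_adj A : T (adj A) = adj (T A).
Proof.
have [/(_ 1 0) + _] :=
  cpT (gram_block_psd (fun i : 'I_2 => if i == 0 then A else 1%:M)).
by rewrite !mxE /= adjmx1 mul1mx mulmx1.
Qed.

(** A Schur complement: the image of the Gram matrix of [(A, 1)] has lower right block [T 1 = 1],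
    and its form is evaluated at [(v, - T(A) v)]. *)
Lemma kadison_schwarz : unital T -> forall A (v : 'cV_d),
  0 <= (adj v *m (T (adj A *m A) - adj (T A) *m T A) *m v) 0 0.
Proof.
move=> T1 A v.
have := @completely_positive_gram 2 (fun i => if i == 0 then A else 1%:M)
  (fun i => if i == 0 then v else - (T A *m v)).
rewrite !big_ord_recl !big_ord0 /= !addr0 adjmx1 !mulmx1 !mul1mx T1 mulmx1.
rewrite completely_positive_adj adjmxN adjmxM !(mulmxN, mulNmx) opprK !mulmxA.
by rewrite addNr addr0 mulmxBr mulmxBl !mulmxA.
Qed.

Lemma unital_contraction : trace_preserving T -> unital T ->
  forall A, hs_inner (T A) (T A) <= hs_inner A A.
Proof.
move=> trT T1 A; rewrite /hs_inner -(trT (adj A *m A)) -subr_ge0 -raddfB /=.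
(* Each diagonal entry of the Kadison-Schwarz difference is its form at a basis vector. *)
apply: sumr_ge0 => i _; have := kadison_schwarz T1 A (delta_mx i 0).
by rewrite adjmx_delta delta_mulmx_delta mxE [delta_mx _ _ _ _]mxE mulr1.
Qed.

End KadisonSchwarz.

(** * Bundling the channel as a linear map and closing the equivalences *)

Lemma linear_repack (R : pzRingType) (U V : lmodType R) (f : U -> V) :
  linear f -> exists g : {linear U -> V}, g = f :> (U -> V).
Proof.
move=> lf; pose L := GRing.isLinear.Build R U V *:%R f lf.
by exists (HB.pack_for {linear U -> V} f L).
Qed.

Theorem theorem1 (R : realType) (d : nat) (T : 'M[R[i]]_d -> 'M[R[i]]_d) :
  quantum_channel T ->
  (unital T <-> hs_convex_unitary T) /\
  (hs_convex_unitary T <-> affine_unitary_conj T).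
Proof.
move=> [/linear_repack[L <-] [cpT trT]].
have c12 : unital L -> hs_convex_unitary L.
  by move=> T1; apply: hs_convex_unitary_contraction; apply: unital_contraction.
have c21 := hs_convex_unitary_unital trT.
have c13 : unital L -> affine_unitary_conj L.
  move=> T1; apply: conj_span_affine (T1); first exact: conj_span_unital_tp T1 trT.
  exact: completely_positive_adj cpT.
have c31 := @affine_unitary_conj_unital _ _ L.
(* The equivalence of (2) and (3) passes through unitality. *)
by do !split; auto.
Qed.
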